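(* Let $Y=\mathbb{R}^m$, let $X$ be a Banach space, and let $\Phi:X\times Y\to\mathbb{R}$ satisfy $\Phi(u;y)\ge0$ together with the following conditions. (A) For every $r>0$ there is a constant $K(r)>0$ with $\Phi(u;y)\le K(r)$ for all $u\in B_X(r)$ and all $y\in B_Y(r)$. (B) For every $r>0$ there is a constant $L(r)>0$ with $|\Phi(u_1;y)-\Phi(u_2;y)|\le L(r)\|u_1-u_2\|_X$ for all $u_1,u_2\in B_X(r)$ and all $y\in B_Y(r)$. (C) There is a positive non-decreasing function $f_2:\mathbb{R}_+\to\mathbb{R}_+$ such that for every $r>0$ there is a constant $C(r)\in\mathbb{R}$ with $|\Phi(u;y_1)-\Phi(u;y_2)|\le C(r)f_2(\|u\|_X)\|y_1-y_2\|_Y$ for all $y_1,y_2\in B_Y(r)$ and all $u\in X$. Let the prior $\mu_0$ be a Borel probability measure on $X$ and for $y,y'\in Y$ let $\mu^y$, $\mu^{y'}$ be the measures defined via Bayes' rule $$\frac{d\mu^y}{d\mu_0}(u)=\frac{1}{Z(y)}\exp(-\Phi(u;y)),\qquad Z(y)=\int_X\exp(-\Phi(u;y))\,d\mu_0(u).$$ Then the posterior measure $\mu^y$ is well-defined and: (i) If $f_2(\|\cdot\|_X)\in L^1(X,\mu_0)$, then for every $r>0$ there exists $C(r)>0$ such that $d_{TV}(\mu^y,\mu^{y'})\le C(r)\|y-y'\|_Y$ for all $y,y'\in B_Y(r)$. (ii) If $f_2(\|\cdot\|_X)\in L^2(X,\mu_0)$, then for every $r>0$ there exists $C'(r)>0$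 such that $d_H(\mu^y,\mu^{y'})\le C'(r)\|y-y'\|_Y$ for all $y,y'\in B_Y(r)$.
   Context: $\mathbb{R}_+=[0,\infty)$. $B_X(r)$ and $B_Y(r)$ denote the open balls of radius $r$ centered at the origin in $X$ and $Y$. $X$ is not assumed separable. All probability measures considered are complete. For probability measures $\mu_1,\mu_2$ absolutely continuous with respect to a measure $\nu$ on $X$, $$d_{TV}(\mu_1,\mu_2)=\frac12\int_X\left|\frac{d\mu_1}{d\nu}-\frac{d\mu_2}{d\nu}\right|d\nu,\qquad d_H(\mu_1,\mu_2)=\left(\frac12\int_X\left(\sqrt{\frac{d\mu_1}{d\nu}}-\sqrt{\frac{d\mu_2}{d\nu}}\right)^2d\nu\right)^{1/2};$$ these do not depend on the choice of $\nu$. *)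

(* Defs.v *)
From HB Require Import structures.
From mathcomp Require Import all_boot all_order all_algebra.
From mathcomp Require Import all_classical all_reals all_analysis.

Set Implicit Arguments.
Unset Strict Implicit.
Unset Printing Implicit Defensive.
Import Order.TTheory GRing.Theory Num.Theory.
Import numFieldNormedType.Exports.

Local Open Scope classical_set_scope.
Local Open Scope ring_scope.
Local Open Scope ereal_scope.
Local Open Scope charge_scope.

(** ['rV[R]_m] is normed by the sup norm in the library, hence a separate
    Euclidean norm. *)
Definition enorm (R : realType) (m : nat) (y : 'rV[R]_m) : R :=
  Num.sqrt (\sum_(i < m) y ord0 i ^+ 2)%R.

Definition eball (R : realType) (m : nat) (r : R) : set 'rV[R]_m :=
  [set y | (enorm y < r)%R].

(** Carathéodory's sigma-algebra of the outer measure induced by [P].  When [P]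
    is a finite measure on a sigma-algebra, this is the [P]-completion of that
    sigma-algebra, i.e. the family of the [A `|` N] with [A] measurable and
    [N] [P]-negligible. *)
Notation completedType P := (caratheodory_type (P^*)%mu).

Section completion.
Context d (T : measurableType d) (R : realType) (P : probability T R).

Definition completion : set (completedType P) -> \bar R :=
  @completed_measure_extension _ _ _ P.

HB.instance Definition _ := Measure.on completion.

Let completion_setT : completion setT = 1.
Proof.
rewrite /completion /completed_measure_extension measurable_mu_extE//.
exact: probability_setT.
Qed.

HB.instance Definition _ :=
  Measure_isProbability.Build _ _ _ completion completion_setT.

End completion.
Arguments completion {d T R} P.

Notation borelType X := (g_sigma_algebraType (@open X)).

Section distances.
Context d (T : measurableType d) (R : realType).
Variables (nu : {sigma_finite_measure set T -> \bar R})
          (mu1 mu2 : probability T R).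

Let p1 : T -> \bar R := 'd (charge_of_finite_measure mu1) '/d nu.
Let p2 : T -> \bar R := 'd (charge_of_finite_measure mu2) '/d nu.

(** These are meaningful only if [mu1 `<< nu] and [mu2 `<< nu]: otherwise
    the Radon-Nikodym derivatives are the dummy value [cst -oo]. *)
Definition d_TV : \bar R := 2^-1%:E * \int[nu]_u `|p1 u - p2 u|.

Definition d_H : \bar R :=
  sqrte (2^-1%:E * \int[nu]_u (sqrte (p1 u) - sqrte (p2 u)) ^+ 2).

End distances.

Section posterior.
Context d (T : measurableType d) (R : realType) (Y : Type).
Variables (mu0 : probability T R) (Phi : T -> Y -> R) (y : Y).

Definition evidence : \bar R := \int[mu0]_u (expR (- Phi u y))%:E.

Definition is_posterior (mu : probability T R) : Prop :=
  mu `<< mu0 /\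
  ('d (charge_of_finite_measure mu) '/d mu0
   = (fun u => ((fine evidence)^-1 * expR (- Phi u y))%:E) %[ae mu0]).

(** A probability is a function on all subsets, with irrelevant values on the
    non-measurable ones; hence the form of the uniqueness clause. *)
Definition posterior_well_defined : Prop :=
  [/\ measurable_fun setT (fun u => expR (- Phi u y)),
      0 < evidence < +oo &
      exists2 mu : probability T R, is_posterior mu /\ measure_is_complete mu &
        forall mu' : probability T R, is_posterior mu' ->
          forall A, measurable A -> mu' A = mu A].

End posterior.

(* Main.v *)
From HB Require Import structures.
Require Import Defs.
From mathcomp Require Import all_boot all_order all_algebra.
From mathcomp Require Import all_classical all_reals all_analysis.
From mathcomp Require Import measurable_realfun ring lra.
Import Order.TTheory GRing.Theory Num.Theory.
Import numFieldNormedType.Exports.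
Local Open Scope classical_set_scope.
Local Open Scope ring_scope.

(** Fix a prior [mu0] and write [w y = exp (- Phi (., y)) / Z y].  The potential
    [Phi (., y)] is Lipschitz on every ball, hence continuous, hence measurable
    for the completed Borel sigma-algebra; it is nonnegative, so
    [0 < Z y <= 1].  Thus [w y] is a positive probability density, and the
    measure with this density is the only posterior.  Since [w y > 0], it has
    the same null sets as [mu0], so it is complete like [mu0].

    The total variation distance and the square of the Hellinger distance are,
    up to the factor 1/2, integrals against [nu] of a positively 1-homogeneous
    function of the pair of densities with respect to [nu].  As [w y > 0], a
    measure [nu] that dominates a posterior dominates [mu0] too; the chain rule
    then pulls [d mu0 / d nu] out of the integrand, and the integrals become
    integrals against [mu0] of the same function of [w y] and [w y']
    ([integral_homogeneous_RN]).

    It remains to estimate these integrals.  Write [g] for a bound of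
    [`|Phi (., y) - Phi (., y')|]; condition (C) provides
    [g u = K * f2 `|u| * enorm (y - y')], so that [\int g], respectively
    [\int g ^ 2], is a finite multiple of [enorm (y - y')], respectively of its
    square, according to the integrability assumed of [f2 `|.|].
    - Total variation: [exp (- .)] is 1-Lipschitz on nonnegative reals, so the
      numerators of [w y] and [w y'] are at L1-distance at most [\int g], and so
      are their integrals [Z y] and [Z y'] ([gibbs_L1_le]).
    - Hellinger: write [h_1 = exp (- Phi (., y) / 2)], [Z_1 = Z y], and [h_2],
      [Z_2] for the same objects at [y'], so that [Z_i = \int h_i ^ 2].
      Expanding squares,
      [\int (h_1 / sqrt Z_1 - h_2 / sqrt Z_2) ^ 2 + (Z_1 + Z_2) / sqrt (Z_1 Z_2)
       = \int (h_1 - h_2) ^ 2 / sqrt (Z_1 Z_2) + 2],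
      and [2 <= (Z_1 + Z_2) / sqrt (Z_1 Z_2)].  Normalising therefore costs only
      the factor [1 / sqrt (Z_1 Z_2)], while [\int (h_1 - h_2) ^ 2] is at most
      [\int g ^ 2 / 4] ([gibbs_Hellinger_le]).
    In both cases [Z y] must be bounded away from 0 for [y] in a ball.
    Comparing [Phi (., y)] with [Phi (., 0)] through (C) gives such a bound,
    since the integral of a positive function is positive
    ([evidence_lower_bound]). *)

(** * Densities and Radon-Nikodym derivatives *)

Section densities.
Local Open Scope ereal_scope.
Local Open Scope charge_scope.
Context {d} {T : measurableType d} {R : realType}.

(** A nonnegative function with zero integral vanishes a.e.; a positive one
    vanishes nowhere. *)
Lemma null_set_of_integral_eq0 {mu : {measure set T -> \bar R}} {A : set T}
    {p : T -> R} : measurable A -> measurable_fun A p ->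
    (forall x, A x -> (0 < p x)%R) ->
  \int[mu]_(x in A) (p x)%:E = 0 -> mu A = 0.
Proof.
move=> mA mp p0 pA0.
move/measurable_EFinP : mp => /(ae_eq_integral_abs mu mA)[+ _].
have -> : \int[mu]_(x in A) `|(EFin \o p) x| = \int[mu]_(x in A) (p x)%:E.
  by apply: eq_integral => x /[!inE] Ax /=; rewrite ger0_norm// ltW// p0.
move=> /(_ pA0) [N [mN N0 subN]].
apply: (subset_measure0 mA mN) => // x Ax; apply: subN => /= /(_ Ax) [] px0.
by have := p0 _ Ax; rewrite px0 ltxx.
Qed.

Lemma ex_probability_density {mu : {measure set T -> \bar R}} {p : T -> R} :
    measurable_fun setT p -> (forall x, (0 <= p x)%R) ->
    \int[mu]_x (p x)%:E = 1 ->
  exists P : probability T R, forall A, P A = \int[mu]_(x in A) (p x)%:E.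
Proof.
move=> mp p0 p1.
pose P (A : set T) := \int[mu]_(x in A) (p x)%:E.
have P0 : P set0 = 0 by rewrite /P integral_set0.
have P_ge0 A : 0 <= P A by apply: integral_ge0 => x _; rewrite lee_fin.
have P_sigma_additive : semi_sigma_additive P.
  move=> F mF tF mUF; rewrite /P ge0_integral_bigcup//.
  - apply: is_cvg_ereal_nneg_natsum_cond => n _ _.
    by apply: integral_ge0 => x _; rewrite lee_fin.
  - exact/measurable_EFinP/measurable_funTS.
  - by move=> x _; rewrite lee_fin.
pose mP := isMeasure.Build _ _ _ P P0 P_ge0 P_sigma_additive.
pose P' : {measure set T -> \bar R} := HB.pack P mP.
pose pP := Measure_isProbability.Build _ _ _ P' p1.
by exists (HB.pack_for (probability T R) P mP pP).
Qed.

Lemma RN_eq_density {P : {finite_measure set T -> \bar R}}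
    {mu : {sigma_finite_measure set T -> \bar R}} {f : T -> \bar R} :
    P `<< mu -> measurable_fun setT f ->
    (forall A, measurable A -> P A = \int[mu]_(x in A) f x) ->
  'd (charge_of_finite_measure P) '/d mu = f %[ae mu].
Proof.
move=> Pmu mf Pf; apply: integral_ae_eq => //.
  exact: Radon_Nikodym_integrable.
by move=> A _ mA; apply: eq_trans (Pf _ mA); rewrite -Radon_Nikodym_integral.
Qed.

Lemma RN_density_integral {P : {finite_measure set T -> \bar R}}
    {mu : {sigma_finite_measure set T -> \bar R}} {f : T -> \bar R} :
    P `<< mu -> measurable_fun setT f ->
    'd (charge_of_finite_measure P) '/d mu = f %[ae mu] ->
  forall A, measurable A -> P A = \int[mu]_(x in A) f x.
Proof.
move=> Pmu mf Pf A mA.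
transitivity (\int[mu]_(x in A) ('d (charge_of_finite_measure P) '/d mu) x).
  by rewrite -Radon_Nikodym_integral.
apply: ae_eq_integral => //.
- apply/measurable_funTS/measurable_int; exact: Radon_Nikodym_integrable.
- exact: measurable_funTS.
- by move: Pf; apply: filterS => x /(_ I).
Qed.

Lemma density_gt0_dominates {P mu : {measure set T -> \bar R}} {p : T -> R} :
    measurable_fun setT p -> (forall x, (0 < p x)%R) ->
    (forall A, measurable A -> P A = \int[mu]_(x in A) (p x)%:E) ->
  mu `<< P.
Proof.
move=> mp p0 Pp; apply/null_content_dominatesP => A mA PA0.
apply: (null_set_of_integral_eq0 mA (measurable_funTS mp)) => //.
exact: eq_trans (esym (Pp _ mA)) PA0.
Qed.

(** With [k = d mu / d nu], the chain rule gives [d P / d nu = p * k] and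
    [d Q / d nu = q * k]; by homogeneity the factor [k] leaves [h], and
    integrating against [k nu] is integrating against [mu].  [H] is the version
    of [h] on extended reals, the codomain of Radon-Nikodym derivatives. *)
Lemma integral_homogeneous_RN {P Q mu : {finite_measure set T -> \bar R}}
    {nu : {sigma_finite_measure set T -> \bar R}} {p q : T -> R}
    (h : R -> R -> R) (H : \bar R -> \bar R -> \bar R) :
    (forall a b, H a%:E b%:E = (h a b)%:E) ->
    measurable_fun setT (fun ab => h ab.1 ab.2) ->
    (forall a b, 0 <= h a b)%R ->
    (forall k a b, 0 <= k -> h (a * k) (b * k) = h a b * k)%R ->
    mu `<< nu -> P `<< nu -> Q `<< nu ->
    measurable_fun setT p -> measurable_fun setT q ->
    (forall x, 0 <= p x)%R -> (forall x, 0 <= q x)%R ->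
    (forall A, measurable A -> P A = \int[mu]_(x in A) (p x)%:E) ->
    (forall A, measurable A -> Q A = \int[mu]_(x in A) (q x)%:E) ->
  \int[nu]_x H ('d (charge_of_finite_measure P) '/d nu x)
               ('d (charge_of_finite_measure Q) '/d nu x) =
  \int[mu]_x (h (p x) (q x))%:E.
Proof.
move=> Hh mh h0 hZ munu Pnu Qnu mp mq p0 q0 Pp Qq.
(* this version of the derivative is nonnegative everywhere, not only a.e. *)
pose k := Radon_Nikodym_SigmaFinite.f mu nu.
have mk : measurable_fun setT k.
  exact: measurable_int (Radon_Nikodym_SigmaFinite.f_integrable munu).
have k_fin x : k x = (fine (k x))%:E.
  by rewrite fineK//; exact: Radon_Nikodym_SigmaFinite.f_fin_num.
have k0 x : (0 <= fine (k x))%R.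
  by rewrite fine_ge0//; exact: Radon_Nikodym_SigmaFinite.f_ge0.
have chain (S : {finite_measure set T -> \bar R}) (s : T -> R) :
    S `<< nu -> measurable_fun setT s -> (forall x, 0 <= s x)%R ->
    (forall A, measurable A -> S A = \int[mu]_(x in A) (s x)%:E) ->
    'd (charge_of_finite_measure S) '/d nu
      = (fun x => (s x)%:E * k x) %[ae nu].
  move=> Snu ms s0 Ss; apply: RN_eq_density => //.
    by apply: emeasurable_funM => //; exact/measurable_EFinP.
  move=> A mA; rewrite Radon_Nikodym_SigmaFinite.change_of_variables//.
    exact: Ss.
  exact/measurable_EFinP/measurable_funTS.
have mRN (S : {finite_measure set T -> \bar R}) : S `<< nu ->
    measurable_fun setT ('d (charge_of_finite_measure S) '/d nu).
  by move=> Snu; apply/measurable_int; exact: Radon_Nikodym_integrable.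
have mhcomp (a b : T -> R) : measurable_fun setT a -> measurable_fun setT b ->
    measurable_fun setT (fun x => (h (a x) (b x))%:E).
  move=> ma mb; apply/measurable_EFinP.
  exact: (measurableT_comp mh (measurable_fun_pair ma mb)).
rewrite -(Radon_Nikodym_SigmaFinite.change_of_variables munu)//; last 2 first.
- by move=> x; rewrite lee_fin.
- exact: mhcomp.
apply: ae_eq_integral => //.
- rewrite (_ : (fun x => H _ _) = fun x =>
    (h (fine ('d (charge_of_finite_measure P) '/d nu x))
       (fine ('d (charge_of_finite_measure Q) '/d nu x)))%:E).
    by apply: mhcomp; apply: measurableT_comp => //; exact: mRN.
  by apply/funext => x; rewrite -Hh !fineK//; exact: Radon_Nikodym_fin_num.
- by apply: emeasurable_funM => //; exact: mhcomp.
- move: (chain _ _ Pnu mp p0 Pp) (chain _ _ Qnu mq q0 Qq).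
  apply: filterS2 => x /(_ I) -> /(_ I) -> _.
  rewrite -/k k_fin -!EFinM Hh hZ// EFinM -k_fin.
Qed.

End densities.

(** * Normalised exponential weights *)

(** If [a <= b] then [expR (- a) - expR (- b)] is
    [expR (- a) * (1 - expR (a - b))], where the first factor is at most 1 and
    the second at most [b - a]. *)
Lemma expRN_lipschitz {R : realType} {a b : R} : 0 <= a -> 0 <= b ->
  `|expR (- a) - expR (- b)| <= `|a - b|.
Proof.
wlog ab : a b / a <= b => [H a0 b0|a0 _].
  have [ab|/ltW ba] := leP a b; first exact: H.
  by rewrite distrC (distrC a); exact: H.
rewrite ger0_norm ?subr_ge0 ?ler_expR ?lerN2// distrC ger0_norm ?subr_ge0//.
have -> : - b = - a + (a - b) by ring.
rewrite expRD.
have e1 : expR (- a) <= 1 by rewrite expR_le1 oppr_le0.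
have := expR_ge1Dx (a - b); have := expR_gt0 (- a).
have : expR (a - b) <= 1 by rewrite expR_le1 subr_le0.
nra.
Qed.

Lemma ler2_addM1 {R : realFieldType} {r s : R} :
  0 <= r -> 0 <= s -> r * s = 1 -> 2 <= r + s.
Proof.
move=> r0 s0 rs; rewrite -(@ler_pXn2r _ 2) ?nnegrE ?addr_ge0//.
have := sqr_ge0 (r - s); lra.
Qed.

Section gibbs.
Local Open Scope ereal_scope.
Context {d} {T : measurableType d} {R : realType}.
Variable mu : {measure set T -> \bar R}.
Implicit Types f g V : T -> R.

Lemma ge0_integral_comb {f g a b} : (0 <= a)%R -> (0 <= b)%R ->
    measurable_fun setT f -> measurable_fun setT g ->
    (forall x, 0 <= f x)%R -> (forall x, 0 <= g x)%R ->
  \int[mu]_x (a * f x + b * g x)%:E =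
  a%:E * \int[mu]_x (f x)%:E + b%:E * \int[mu]_x (g x)%:E.
Proof.
move=> a0 b0 mf mg f0 g0.
under eq_integral do rewrite EFinD !EFinM.
rewrite ge0_integralD//.
- rewrite !ge0_integralZl//; first exact/measurable_EFinP.
  all: try by move=> x _; rewrite lee_fin.
  exact/measurable_EFinP.
- by move=> x _; rewrite -EFinM lee_fin mulr_ge0.
- by apply: emeasurable_funM => //; exact/measurable_EFinP.
- by move=> x _; rewrite -EFinM lee_fin mulr_ge0.
- by apply: emeasurable_funM => //; exact/measurable_EFinP.
Qed.

Context {V1 V2 g : T -> R} {Z1 Z2 : R}.
Hypotheses (mV1 : measurable_fun setT V1) (mV2 : measurable_fun setT V2)
  (mg : measurable_fun setT g).
Hypotheses (V1_ge0 : forall x, (0 <= V1 x)%R) (V2_ge0 : forall x, (0 <= V2 x)%R).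
Hypothesis V12 : forall x, (`|V1 x - V2 x| <= g x)%R.
Hypotheses (Z1E : \int[mu]_x (expR (- V1 x))%:E = Z1%:E)
  (Z2E : \int[mu]_x (expR (- V2 x))%:E = Z2%:E).
Hypotheses (Z1_gt0 : (0 < Z1)%R) (Z2_gt0 : (0 < Z2)%R).

Let mexp V : measurable_fun setT V -> measurable_fun setT (fun x => expR (- V x)).
Proof. by move=> mV; do 2 apply: measurableT_comp => //. Qed.

Let Z1_neq0 : Z1 != 0%R. Proof. by rewrite gt_eqF. Qed.
Let Z2_neq0 : Z2 != 0%R. Proof. by rewrite gt_eqF. Qed.

Let g_ge0 x : (0 <= g x)%R.
Proof. exact: le_trans (V12 x). Qed.

(** Integrate [expR (- V1) <= expR (- V2) + g] and the symmetric bound. *)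
Lemma normalisation_lipschitz {G} : \int[mu]_x (g x)%:E = G%:E ->
  (`|Z1 - Z2| <= G)%R.
Proof.
move=> GE.
have le_add (U W : T -> R) (x y : R) :
    measurable_fun setT U -> measurable_fun setT W ->
    (forall t, 0 <= U t)%R -> (forall t, 0 <= W t)%R ->
    (forall t, `|U t - W t| <= g t)%R ->
    \int[mu]_t (expR (- U t))%:E = x%:E -> \int[mu]_t (expR (- W t))%:E = y%:E ->
    (x <= y + G)%R.
  move=> mU mW U0 W0 UW xE yE; rewrite -lee_fin -xE EFinD -yE -GE.
  have -> : \int[mu]_t (expR (- W t))%:E + \int[mu]_t (g t)%:E =
      \int[mu]_t (1 * expR (- W t) + 1 * g t)%:E.
    rewrite ge0_integral_comb ?mul1e//; exact: mexp.
  apply: ge0_le_integral => //.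
  - exact/measurable_EFinP/mexp.
  - apply/measurable_EFinP/measurable_funD; apply: measurable_funM => //; exact: mexp.
  - move=> t _; rewrite lee_fin !mul1r -lerBlDl.
    exact: le_trans (ler_norm _) (le_trans (expRN_lipschitz (U0 t) (W0 t)) (UW t)).
rewrite ler_distlC; apply/andP; split.
  rewrite lerBlDr.
  exact: (le_add V1 V2).
by apply: (le_add V2 V1) => // t; rewrite distrC.
Qed.

(** Passing from [V1] to [V2] first in the numerator and then in the
    normalisation costs [Z1^-1 * G] each time. *)
Lemma gibbs_L1_le {G} : \int[mu]_x (g x)%:E = G%:E ->
  \int[mu]_x (`|Z1^-1 * expR (- V1 x) - Z2^-1 * expR (- V2 x)|)%:E
  <= (2 * Z1^-1 * G)%:E.
Proof.
move=> GE; have ZG := normalisation_lipschitz GE.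
pose b := (Z1^-1 * Z2^-1 * `|Z1 - Z2|)%R.
have b0 : (0 <= b)%R by rewrite !mulr_ge0// invr_ge0 ltW.
have iZ1_ge0 : (0 <= Z1^-1)%R by rewrite invr_ge0 ltW.
have iZ2_ge0 : (0 <= Z2^-1)%R by rewrite invr_ge0 ltW.
apply: (@le_trans _ _ (\int[mu]_x (Z1^-1 * g x + b * expR (- V2 x))%:E)).
  apply: ge0_le_integral => //.
  - apply/measurable_EFinP; apply: measurableT_comp => //.
    by apply: measurable_funB; apply: measurable_funM => //; exact: mexp.
  - apply/measurable_EFinP/measurable_funD; apply: measurable_funM => //; exact: mexp.
  move=> x _; rewrite lee_fin.
  have -> : (Z1^-1 * expR (- V1 x) - Z2^-1 * expR (- V2 x) =
     Z1^-1 * (expR (- V1 x) - expR (- V2 x)) +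
     Z1^-1 * Z2^-1 * (Z2 - Z1) * expR (- V2 x))%R.
    by field; rewrite Z1_neq0 Z2_neq0.
  apply: le_trans (ler_normD _ _) _; apply: lerD.
    rewrite normrM (ger0_norm iZ1_ge0) ler_wpM2l//.
    exact: le_trans (expRN_lipschitz (V1_ge0 x) (V2_ge0 x)) (V12 x).
  rewrite !normrM (ger0_norm iZ1_ge0) (ger0_norm iZ2_ge0).
  by rewrite (ger0_norm (expR_ge0 _)) (distrC Z2).
rewrite ge0_integral_comb//; last exact: mexp.
rewrite GE Z2E -!EFinM -EFinD lee_fin.
have -> : (b * Z2 = Z1^-1 * `|Z1 - Z2|)%R by rewrite /b; field; rewrite Z1_neq0 Z2_neq0.
by rewrite -mulrA mulrDl mul1r lerD2l ler_wpM2l.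
Qed.

(** Normalisation is handled exactly rather than by a triangle inequality, so
    that only the second moment of [g] enters. *)
Lemma gibbs_Hellinger_le {c G} : (0 < c)%R -> (c <= Z1)%R -> (c <= Z2)%R ->
  \int[mu]_x (g x ^+ 2)%:E = G%:E ->
  \int[mu]_x ((Num.sqrt (Z1^-1 * expR (- V1 x)) -
               Num.sqrt (Z2^-1 * expR (- V2 x))) ^+ 2)%:E
  <= ((4 * c)^-1 * G)%:E.
Proof.
move=> c0 cZ1 cZ2 GE.
pose a := Num.sqrt Z1^-1; pose b := Num.sqrt Z2^-1.
have a0 : (0 < a)%R by rewrite sqrtr_gt0 invr_gt0.
have b0 : (0 < b)%R by rewrite sqrtr_gt0 invr_gt0.
have aE : (a ^+ 2 = Z1^-1)%R by rewrite sqr_sqrtr// invr_ge0 ltW.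
have bE : (b ^+ 2 = Z2^-1)%R by rewrite sqr_sqrtr// invr_ge0 ltW.
have aZ : (a ^+ 2 * Z1 = 1)%R by rewrite aE mulVf// gt_eqF.
have bZ : (b ^+ 2 * Z2 = 1)%R by rewrite bE mulVf// gt_eqF.
have G0 : (0 <= G)%R.
  by rewrite -lee_fin -GE; apply: integral_ge0 => x _; rewrite lee_fin sqr_ge0.
set J := \int[mu]_x _.
have mJ : measurable_fun setT (fun x => (Num.sqrt (Z1^-1 * expR (- V1 x)) -
    Num.sqrt (Z2^-1 * expR (- V2 x))) ^+ 2)%R.
  have msqrt : measurable_fun setT (@Num.sqrt R).
    by apply: continuous_measurable_fun; exact: sqrt_continuous.
  apply: measurable_funX; apply: measurable_funB.
    apply: (measurableT_comp msqrt); apply: measurable_funM => //; exact: mexp.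
  apply: (measurableT_comp msqrt); apply: measurable_funM => //; exact: mexp.
(* with [h_i = expR (- V_i / 2)], this follows by integrating the identity
   [(a h_1 - b h_2)^2 + a b (h_1^2 + h_2^2)
    = a b (h_1 - h_2)^2 + a^2 h_1^2 + b^2 h_2^2] and the bound
   [(h_1 - h_2)^2 <= g^2 / 4]; arranged as sums of nonnegative terms, both sides
   can be integrated termwise before [J] is known to be finite *)
suff : J + (a * b * (Z1 + Z2))%:E <= (a * b / 4 * G)%:E + 2%:E.
  move=> H.
  have J0 : 0 <= J by apply: integral_ge0 => x _; rewrite lee_fin sqr_ge0.
  have Jfin : J \is a fin_num.
    rewrite ge0_fin_numE//; apply: (@le_lt_trans _ _ ((a * b / 4 * G)%:E + 2%:E)).
      apply: le_trans H; rewrite leeDl// lee_fin.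
      by rewrite !mulr_ge0 ?addr_ge0 ?(ltW a0) ?(ltW b0) ?(ltW Z1_gt0) ?(ltW Z2_gt0).
    by rewrite -EFinD ltry.
  move: H; rewrite -(fineK Jfin) -!EFinD !lee_fin => H.
  (* [a b Z1] and [a b Z2] are inverse to each other because
     [a^2 Z1 = b^2 Z2 = 1] *)
  have AG : (2 <= a * b * (Z1 + Z2))%R.
    pose r := (a * b * Z1)%R; pose s := (a * b * Z2)%R.
    have rs : (r * s = 1)%R.
      by rewrite -[RHS]mulr1 -{1}aZ -bZ /r /s; ring.
    have r0 : (0 <= r)%R by rewrite !mulr_ge0 ?ltW.
    have s0 : (0 <= s)%R by rewrite !mulr_ge0 ?ltW.
    by rewrite mulrDr; exact: ler2_addM1.
  have iZ Z : (c <= Z)%R -> (Z^-1 <= c^-1)%R.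
    by move=> cZ; rewrite lef_pV2// posrE (lt_le_trans c0).
  have abc : (a * b <= c^-1)%R.
    have := sqr_ge0 (a - b); have := iZ _ cZ1; have := iZ _ cZ2.
    rewrite -aE -bE; lra.
  have abG : (a * b * G <= c^-1 * G)%R by rewrite ler_wpM2r.
  have -> : ((4 * c)^-1 * G = c^-1 * G / 4)%R by field; rewrite gt_eqF.
  lra.
have exp_sqr (t : R) : (expR (- t) = expR (- (t / 2)) ^+ 2)%R.
  by rewrite -expRM_natl; congr expR; field.
have sqrtE (u t : R) : (0 < u)%R -> (Num.sqrt (u * expR (- t)) =
    Num.sqrt u * expR (- (t / 2)))%R.
  by move=> u0; rewrite sqrtrM ?ltW// exp_sqr sqrtr_sqr ger0_norm ?expR_ge0.
have ab0 : (0 <= a * b)%R by rewrite mulr_ge0 ?ltW.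
have -> : J + (a * b * (Z1 + Z2))%:E = \int[mu]_x (1 * ((Num.sqrt (Z1^-1 * expR (- V1 x)) -
    Num.sqrt (Z2^-1 * expR (- V2 x))) ^+ 2) +
    a * b * (1 * expR (- V1 x) + 1 * expR (- V2 x)))%:E.
  rewrite ge0_integral_comb//.
  - rewrite mul1e ge0_integral_comb// ?Z1E ?Z2E ?mul1e -?EFinD -?EFinM//.
    + exact: mexp.
    + exact: mexp.
  - by apply: measurable_funD; apply: measurable_funM => //; exact: mexp.
  - by move=> x; exact: sqr_ge0.
have -> : (a * b / 4 * G)%:E + 2%:E =
    \int[mu]_x (a * b / 4 * g x ^+ 2 +
    1 * (a ^+ 2 * expR (- V1 x) + b ^+ 2 * expR (- V2 x)))%:E.
  rewrite ge0_integral_comb//.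
  - rewrite mul1e ge0_integral_comb ?sqr_ge0// ?Z1E ?Z2E ?GE -?EFinD -?EFinM ?aZ ?bZ//.
    + exact: mexp.
    + exact: mexp.
  - by rewrite mulr_ge0// invr_ge0.
  - exact: measurable_funX.
  - by apply: measurable_funD; apply: measurable_funM => //; exact: mexp.
  - by move=> x; exact: sqr_ge0.
  - by move=> x; rewrite addr_ge0// mulr_ge0 ?sqr_ge0 ?expR_ge0.
apply: ge0_le_integral => //.
- move=> x _; rewrite lee_fin; apply: addr_ge0; first by rewrite mul1r sqr_ge0.
  by rewrite !mul1r mulr_ge0// addr_ge0 ?expR_ge0.
- apply/measurable_EFinP/measurable_funD; first exact: measurable_funM.
  apply: measurable_funM => //.
  by apply: measurable_funD; apply: measurable_funM => //; exact: mexp.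
- apply/measurable_EFinP/measurable_funD.
    by apply: measurable_funM => //; exact: measurable_funX.
  apply: measurable_funM => //.
  by apply: measurable_funD; apply: measurable_funM => //; exact: mexp.
move=> x _; rewrite lee_fin !sqrtE ?invr_gt0// -/a -/b.
have := @expRN_lipschitz _ (V1 x / 2) (V2 x / 2).
rewrite !divr_ge0// => /(_ isT isT).
rewrite (exp_sqr (V1 x)) (exp_sqr (V2 x)) -mulrBl normrM (ger0_norm (_ : 0 <= 2^-1)%R)//.
set h1 := expR _; set h2 := expR _ => h12.
have h12g : ((h1 - h2) ^+ 2 <= g x ^+ 2 / 4)%R.
  have -> : (g x ^+ 2 / 4 = (g x / 2) ^+ 2)%R by field.
  rewrite -real_normK ?num_real// ler_sqr ?nnegrE ?divr_ge0//.
  by apply: le_trans h12 _; rewrite ler_wpM2r// V12.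
have := ler_wpM2l ab0 h12g; lra.
Qed.

End gibbs.

(** * Posterior measures and their distances *)

Section bayes.
Local Open Scope ereal_scope.
Local Open Scope charge_scope.
Context {d} {T : measurableType d} {R : realType} {Y : Type}.
Context {mu0 : probability T R} {Phi : T -> Y -> R}.
Hypothesis Phi_ge0 : forall u y, (0 <= Phi u y)%R.
Hypothesis mPhi : forall y, measurable_fun setT (Phi^~ y).

Let mexpR y : measurable_fun setT (fun u => expR (- Phi u y)).
Proof. by do 2 apply: measurableT_comp => //; exact: mPhi. Qed.

Lemma integral_expR_gt0 {V : T -> R} : measurable_fun setT V ->
  0 < \int[mu0]_u (expR (- V u))%:E.
Proof.
move=> mV; rewrite lt_def integral_ge0 ?andbT; last first.
  by move=> u _; rewrite lee_fin expR_ge0.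
have mexp : measurable_fun setT (fun u => expR (- V u)).
  by do 2 apply: measurableT_comp => //.
apply/eqP => /(null_set_of_integral_eq0 measurableT mexp (fun _ _ => expR_gt0 _)).
by move/eqP; rewrite [_ == _](_ : (mu0 setT == 0) = false)// probability_setT onee_eq0.
Qed.

Lemma integral_expR_le1 {V : T -> R} : measurable_fun setT V ->
  (forall u, 0 <= V u)%R -> \int[mu0]_u (expR (- V u))%:E <= 1.
Proof.
move=> mV V0; rewrite -(probability_setT mu0) -(mul1e (mu0 setT)) -integral_cst//.
apply: ge0_le_integral => //.
- by apply/measurable_EFinP; do 2 apply: measurableT_comp => //.
- by move=> u _; rewrite lee_fin expR_le1 oppr_le0.
Qed.

Lemma integral_expR_fin {V : T -> R} : measurable_fun setT V ->
  (forall u, 0 <= V u)%R -> \int[mu0]_u (expR (- V u))%:E \is a fin_num.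
Proof.
move=> mV V0; rewrite gt0_fin_numE ?integral_expR_gt0//.
exact: le_lt_trans (integral_expR_le1 mV V0) (ltry _).
Qed.

Lemma evidenceE y : evidence mu0 Phi y = (fine (evidence mu0 Phi y))%:E.
Proof. by rewrite fineK// integral_expR_fin. Qed.

Lemma fine_evidence_gt0 y : (0 < fine (evidence mu0 Phi y))%R.
Proof. by rewrite -lte_fin -evidenceE integral_expR_gt0. Qed.

Definition bayes_weight y u : R :=
  ((fine (evidence mu0 Phi y))^-1 * expR (- Phi u y))%R.

Lemma bayes_weight_gt0 y u : (0 < bayes_weight y u)%R.
Proof. by rewrite mulr_gt0 ?expR_gt0// invr_gt0 fine_evidence_gt0. Qed.

Lemma measurable_bayes_weight y : measurable_fun setT (bayes_weight y).
Proof. exact: measurable_funM. Qed.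

Lemma integral_bayes_weight y : \int[mu0]_u (bayes_weight y u)%:E = 1.
Proof.
under eq_integral do rewrite EFinM.
rewrite ge0_integralZl//.
- rewrite -/(evidence mu0 Phi y) [X in _ * X]evidenceE -EFinM mulVf//.
  by rewrite gt_eqF ?fine_evidence_gt0.
- exact/measurable_EFinP.
- by rewrite lee_fin invr_ge0 ltW ?fine_evidence_gt0.
Qed.

Lemma posterior_integral {y} {mu : probability T R} : is_posterior mu0 Phi y mu ->
  forall A, measurable A -> mu A = \int[mu0]_(u in A) (bayes_weight y u)%:E.
Proof.
move=> [mumu0 muE]; apply: RN_density_integral => //.
exact/measurable_EFinP/measurable_bayes_weight.
Qed.

(** The density is positive, so a posterior-null set is prior-null; this is how
    completeness passes from the prior to the posterior. *)
Lemma posterior_well_definedT y :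
  measure_is_complete mu0 -> posterior_well_defined mu0 Phi y.
Proof.
move=> mu0_complete; split; first exact: mexpR.
  rewrite integral_expR_gt0//=.
  exact: le_lt_trans (integral_expR_le1 (mPhi y) (Phi_ge0^~ y)) (ltry _).
have w0 u := ltW (bayes_weight_gt0 y u).
have [mu muE] :=
  ex_probability_density (measurable_bayes_weight y) w0 (integral_bayes_weight y).
have mumu0 : mu `<< mu0.
  apply/null_content_dominatesP => A mA A0; apply: eq_trans (muE _) _.
  apply: null_set_integral => //.
  exact/measurable_EFinP/measurable_funTS/measurable_bayes_weight.
exists mu.
  split.
    split=> //; apply: RN_eq_density => // [|A _]; last exact: muE.
    exact/measurable_EFinP/measurable_bayes_weight.
  move=> N [A [mA A0 NA]]; apply: mu0_complete; exists A; split => //.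
  apply: (null_set_of_integral_eq0 mA _ (fun x _ => bayes_weight_gt0 y x)).
    exact/measurable_funTS/measurable_bayes_weight.
  by rewrite -muE.
by move=> mu' /posterior_integral mu'E A mA; rewrite mu'E// muE.
Qed.

(** By transitivity, every measure dominating a posterior dominates the prior,
    as the change of variables from [nu] to the prior requires. *)
Lemma posterior_dominates {y} {mu : probability T R} : is_posterior mu0 Phi y mu ->
  mu0 `<< mu.
Proof.
move=> /posterior_integral muE.
exact: density_gt0_dominates (measurable_bayes_weight y) (bayes_weight_gt0 y) muE.
Qed.

Context {y y' : Y} {mu mu' : probability T R}.
Context {nu : {sigma_finite_measure set T -> \bar R}}.
Hypotheses (pmu : is_posterior mu0 Phi y mu) (pmu' : is_posterior mu0 Phi y' mu').
Hypotheses (munu : mu `<< nu) (mu'nu : mu' `<< nu).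

Let mu0nu : mu0 `<< nu.
Proof. exact: null_dominates_trans (posterior_dominates pmu) munu. Qed.

Lemma d_TV_posterior : d_TV nu mu mu' =
  2^-1%:E * \int[mu0]_u (`|bayes_weight y u - bayes_weight y' u|)%:E.
Proof.
congr (_ * _).
apply: (integral_homogeneous_RN (fun a b => `|a - b|%R) (fun a b => `|a - b|)
  _ _ _ _ mu0nu munu mu'nu (measurable_bayes_weight y) (measurable_bayes_weight y')
  _ _ (posterior_integral pmu) (posterior_integral pmu')) => //.
- by apply: measurableT_comp => //; apply: measurable_funB.
- by move=> k a b k0; rewrite -mulrBl normrM (ger0_norm k0).
- by move=> x; exact/ltW/bayes_weight_gt0.
- by move=> x; exact/ltW/bayes_weight_gt0.
Qed.

Lemma d_H_posterior : d_H nu mu mu' =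
  sqrte (2^-1%:E * \int[mu0]_u
    ((Num.sqrt (bayes_weight y u) - Num.sqrt (bayes_weight y' u)) ^+ 2)%:E).
Proof.
congr (sqrte (_ * _)).
apply: (integral_homogeneous_RN (fun a b => (Num.sqrt a - Num.sqrt b) ^+ 2)%R
  (fun a b => (sqrte a - sqrte b) ^+ 2)
  _ _ _ _ mu0nu munu mu'nu (measurable_bayes_weight y) (measurable_bayes_weight y')
  _ _ (posterior_integral pmu) (posterior_integral pmu')) => //.
- apply: measurable_funX; apply: measurable_funB; apply: measurableT_comp => //;
  by apply: continuous_measurable_fun; exact: sqrt_continuous.
- by move=> a b; exact: sqr_ge0.
- move=> k a b k0; rewrite mulrC [(b * k)%R]mulrC !sqrtrM// -mulrBr exprMn sqr_sqrtr//.
  by rewrite mulrC.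
- by move=> x; exact/ltW/bayes_weight_gt0.
- by move=> x; exact/ltW/bayes_weight_gt0.
Qed.

End bayes.

(** * Stability with respect to the data *)

Lemma continuous_measurable_completion {R : realType} {X : completeNormedModType R}
    (prior : probability (borelType X) R) (f : X -> R) :
  continuous f -> measurable_fun setT (f : completedType prior -> R).
Proof.
move=> cf; apply: (measurability _ (RGenOpens.measurableE R)).
move=> _ [_ [a [b ->]] <-]; rewrite setTI.
apply: caratheodory_measurable_mu_ext; apply: sub_sigma_algebra.
by apply: open_comp => [x _|]; [exact: cf | exact: itv_open].
Qed.

Lemma enorm_ge0 {R : realType} {m : nat} (y : 'rV[R]_m) : 0 <= enorm y.
Proof. exact: sqrtr_ge0. Qed.

Lemma enorm0 {R : realType} {m : nat} : enorm (0 : 'rV[R]_m) = 0.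
Proof. by rewrite /enorm big1 ?sqrtr0// => i _; rewrite mxE expr0n. Qed.

Lemma ball_lipschitz_continuous {R : realType} {X : completeNormedModType R}
    {f : X -> R} :
    (forall r, 0 < r -> exists L, forall u1 u2 : X, ball 0 r u1 -> ball 0 r u2 ->
      `|f u1 - f u2| <= L * `|u1 - u2|) ->
  continuous f.
Proof.
move=> fL u; have [|L fuL] := fL (`|u| + 1); first by rewrite ltr_wpDl.
have ballE (v : X) : ball 0 (`|u| + 1) v = (`|v| < `|u| + 1).
  by rewrite -ball_normE /ball_/= sub0r normrN.
apply/cvgrPdist_lt => e e0.
have K0 : 0 < `|L| + 1 by rewrite ltr_wpDl.
near=> v.
have uv1 : `|u - v| < 1 by near: v; apply: cvgr_dist_lt.
have uve : `|u - v| < e / (`|L| + 1).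
  by near: v; apply: cvgr_dist_lt => //; rewrite divr_gt0.
apply: (@le_lt_trans _ _ ((`|L| + 1) * `|u - v|)).
  apply: le_trans (fuL u v _ _) _; rewrite ?ballE ?ltrDl//.
    rewrite -[v in `|v|](subrK u) addrC (le_lt_trans (ler_normD _ _))//.
    by rewrite ltrD2l distrC.
  by rewrite ler_wpM2r// (le_trans (ler_norm L))// lerDl.
by rewrite mulrC -ltr_pdivlMr.
Unshelve. all: by end_near.
Qed.

(** An abstract form of the setting: of the Banach space, only the measurable
    space with the function [h u = f2 `|u|] is kept. *)
Section stability.
Context {d} {T : measurableType d} {R : realType} {m : nat}.
Context {mu0 : probability T R} {Phi : T -> 'rV[R]_m -> R} {h : T -> R}.
Hypothesis Phi_ge0 : forall u y, 0 <= Phi u y.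
Hypothesis mPhi : forall y, measurable_fun setT (Phi^~ y).
Hypothesis h_ge0 : forall u, 0 <= h u.
Hypothesis Phi_lip : forall r : R, 0 < r -> exists C : R,
  forall (y1 y2 : 'rV[R]_m) (u : T), eball r y1 -> eball r y2 ->
    `|Phi u y1 - Phi u y2| <= C * h u * enorm (y1 - y2).

Let Phi_lip_pos r : 0 < r -> exists2 K : R, 0 < K & forall y1 y2 u,
    eball r y1 -> eball r y2 ->
    `|Phi u y1 - Phi u y2| <= K * enorm (y1 - y2) * h u.
Proof.
move=> r0; have [C PhiC] := Phi_lip r r0.
exists (`|C| + 1); first by rewrite ltr_wpDl.
move=> y1 y2 u y1r y2r; apply: le_trans (PhiC y1 y2 u y1r y2r) _.
rewrite mulrAC ler_wpM2r// ler_wpM2r ?enorm_ge0//.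
by rewrite (le_trans (ler_norm C))// lerDl.
Qed.

(** On [eball r], [Phi u y <= Phi u 0 + K * r * h u], a finite potential that
    does not depend on [y]; its evidence is the lower bound. *)
Lemma evidence_lower_bound {r} : 0 < r -> measurable_fun setT h ->
  exists2 c : R, 0 < c & forall y, eball r y -> c <= fine (evidence mu0 Phi y).
Proof.
move=> r0 mh; have [K K0 PhiK] := Phi_lip_pos r r0.
pose V (u : T) := Phi u 0 + K * r * h u.
have mV : measurable_fun setT V.
  by apply: measurable_funD; [exact: mPhi | exact: measurable_funM].
have V0 u : 0 <= V u by rewrite addr_ge0// mulr_ge0// mulr_ge0 ?ltW.
exists (fine (\int[mu0]_u (expR (- V u))%:E)%E).
  by rewrite fine_gt0// integral_expR_gt0//= ltey_eq integral_expR_fin.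
move=> y yr; apply: fine_le; [exact: integral_expR_fin..|].
apply: ge0_le_integral => //.
- by apply/measurable_EFinP; do 2 apply: measurableT_comp => //.
- by apply/measurable_EFinP; do 2 apply: measurableT_comp => //; exact: mPhi.
move=> u _; rewrite lee_fin ler_expR lerN2 /V -lerBlDl.
apply: le_trans (ler_norm _) _; apply: le_trans (PhiK y 0 u yr _) _.
  by rewrite /eball/= enorm0.
by rewrite subr0 ler_wpM2r// ler_wpM2l ?(ltW K0)// ltW.
Qed.

Lemma d_TV_lipschitz : h \in Lfun mu0 1 ->
  forall r : R, 0 < r -> exists2 C : R, 0 < C &
    forall y y' : 'rV[R]_m, eball r y -> eball r y' ->
    forall mu mu' : probability T R,
      is_posterior mu0 Phi y mu -> is_posterior mu0 Phi y' mu' ->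
    forall nu : {sigma_finite_measure set T -> \bar R},
      mu `<< nu -> mu' `<< nu ->
      (d_TV nu mu mu' <= (C * enorm (y - y'))%:E)%E.
Proof.
move=> /Lfun1_integrable ih r r0.
have mh : measurable_fun setT h by apply/measurable_EFinP/measurable_int/ih.
have [K K0 PhiK] := Phi_lip_pos r r0.
have [c c0 cZ] := evidence_lower_bound r0 mh.
pose H := fine (\int[mu0]_u (h u)%:E)%E.
have H0 : 0 <= H by apply/fine_ge0/integral_ge0 => u _; rewrite lee_fin.
have HE : (\int[mu0]_u (h u)%:E = H%:E)%E.
  by rewrite /H fineK//; exact: integrable_fin_num.
(* the summand 1 makes the constant positive even if [H = 0] *)
exists (c^-1 * K * H + 1).
  by rewrite ltr_wpDl// !mulr_ge0// ?invr_ge0 ltW.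
move=> y y' yr y'r mu mu' pmu pmu' nu munu mu'nu.
have e0 : 0 <= enorm (y - y') by exact: enorm_ge0.
have gE : (\int[mu0]_u (K * enorm (y - y') * h u)%:E =
    (K * enorm (y - y') * H)%:E)%E.
  under eq_integral do rewrite EFinM.
  rewrite ge0_integralZl ?HE//.
  - exact/measurable_EFinP.
  - by move=> u _; rewrite lee_fin.
  - by rewrite lee_fin mulr_ge0// ltW.
have Z0 t : 0 < fine (evidence mu0 Phi t) by exact: fine_evidence_gt0.
have mg : measurable_fun setT (fun u => K * enorm (y - y') * h u).
  exact: measurable_funM.
have := gibbs_L1_le mu0 (mPhi y) (mPhi y') mg
  (Phi_ge0^~ y) (Phi_ge0^~ y') (fun u => PhiK y y' u yr y'r)
  (evidenceE Phi_ge0 mPhi y) (evidenceE Phi_ge0 mPhi y') (Z0 y) (Z0 y') gE.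
rewrite (d_TV_posterior Phi_ge0 mPhi pmu pmu' munu mu'nu).
have half_ge0 : (0 <= 2^-1%:E :> \bar R)%E by rewrite lee_fin.
move=> /(lee_wpmul2l half_ge0) /le_trans; apply.
rewrite -EFinM lee_fin.
have Zc : (fine (evidence mu0 Phi y))^-1 <= c^-1.
  by rewrite lef_pV2 ?posrE//; exact: cZ.
rewrite [leLHS](_ : _ = (fine (evidence mu0 Phi y))^-1 * (K * H * enorm (y - y'))).
  rewrite mulrDl mul1r (@le_trans _ _ (c^-1 * (K * H * enorm (y - y'))))//.
    by rewrite ler_wpM2r// !mulr_ge0// ltW.
  by rewrite !mulrA lerDl.
by field; rewrite gt_eqF.
Qed.

Lemma d_H_lipschitz : h \in Lfun mu0 2%:E ->
  forall r : R, 0 < r -> exists2 C : R, 0 < C &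
    forall y y' : 'rV[R]_m, eball r y -> eball r y' ->
    forall mu mu' : probability T R,
      is_posterior mu0 Phi y mu -> is_posterior mu0 Phi y' mu' ->
    forall nu : {sigma_finite_measure set T -> \bar R},
      mu `<< nu -> mu' `<< nu ->
      (d_H nu mu mu' <= (C * enorm (y - y'))%:E)%E.
Proof.
move=> hL2 r r0.
have mh : measurable_fun setT h by move: hL2; rewrite inE => /andP[]; rewrite inE.
have ih := Lfun2_integrable_sqr hL2.
have [K K0 PhiK] := Phi_lip_pos r r0.
have [c c0 cZ] := evidence_lower_bound r0 mh.
pose H := fine (\int[mu0]_u (h u ^+ 2)%:E)%E.
have H0 : 0 <= H by apply/fine_ge0/integral_ge0 => u _; rewrite lee_fin sqr_ge0.
have HE : (\int[mu0]_u (h u ^+ 2)%:E = H%:E)%E.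
  by rewrite /H fineK//; exact: (integrable_fin_num _ ih).
(* 8 is the 4 of the bound on normalised weights times the 2 of [d_H] *)
exists (K * Num.sqrt ((8 * c)^-1 * H) + 1).
  by rewrite ltr_wpDl// mulr_ge0 ?sqrtr_ge0 ?ltW.
move=> y y' yr y'r mu mu' pmu pmu' nu munu mu'nu.
have e0 : 0 <= enorm (y - y') by exact: enorm_ge0.
have gE : (\int[mu0]_u ((K * enorm (y - y') * h u) ^+ 2)%:E =
    ((K * enorm (y - y')) ^+ 2 * H)%:E)%E.
  under eq_integral do rewrite exprMn EFinM.
  rewrite ge0_integralZl ?HE//.
  - by apply/measurable_EFinP; exact: measurable_funX.
  - by move=> u _; rewrite lee_fin sqr_ge0.
  - by rewrite lee_fin sqr_ge0.
have Z0 t : 0 < fine (evidence mu0 Phi t) by exact: fine_evidence_gt0.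
have mg : measurable_fun setT (fun u => K * enorm (y - y') * h u).
  exact: measurable_funM.
have := gibbs_Hellinger_le mu0 (mPhi y) (mPhi y') mg
  (Phi_ge0^~ y) (Phi_ge0^~ y') (fun u => PhiK y y' u yr y'r)
  (evidenceE Phi_ge0 mPhi y) (evidenceE Phi_ge0 mPhi y') (Z0 y) (Z0 y')
  c0 (cZ y yr) (cZ y' y'r) gE.
rewrite (d_H_posterior Phi_ge0 mPhi pmu pmu' munu mu'nu).
have half_ge0 : (0 <= 2^-1%:E :> \bar R)%E by rewrite lee_fin.
move=> /(lee_wpmul2l half_ge0); rewrite -EFinM.
rewrite [X in (_ <= X%:E)%E](_ : _ =
    (K * enorm (y - y')) ^+ 2 * ((8 * c)^-1 * H)); last by field; rewrite gt_eqF.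
rewrite -lee_sqrt ?lee_fin; last first.
  by rewrite mulr_ge0 ?sqr_ge0// mulr_ge0// invr_ge0 mulr_ge0// ltW.
move=> /le_trans; apply; rewrite lee_fin sqrtrM ?sqr_ge0// sqrtr_sqr.
rewrite ger0_norm; last by rewrite mulr_ge0// ltW.
by rewrite mulrAC ler_wpM2r// lerDl.
Qed.

End stability.

Theorem corollary4p6 (R : realType) (m : nat) (X : completeNormedModType R)
    (Phi : X -> 'rV[R]_m -> R) (f2 : R -> R)
    (prior : probability (borelType X) R)
    (Phi_ge0 : forall u y, 0 <= Phi u y)
    (hA : forall r : R, 0 < r -> exists2 K : R, 0 < K &
      forall (u : X) (y : 'rV[R]_m), ball 0 r u -> eball r y -> Phi u y <= K)
    (hB : forall r : R, 0 < r -> exists2 L : R, 0 < L &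
      forall (u1 u2 : X) (y : 'rV[R]_m),
        ball 0 r u1 -> ball 0 r u2 -> eball r y ->
        `|Phi u1 y - Phi u2 y| <= L * `|u1 - u2|)
    (f2_gt0 : forall t : R, 0 <= t -> 0 < f2 t)
    (f2_nondecreasing : forall s t : R, 0 <= s -> s <= t -> f2 s <= f2 t)
    (hC : forall r : R, 0 < r -> exists C : R,
      forall (y1 y2 : 'rV[R]_m) (u : X), eball r y1 -> eball r y2 ->
        `|Phi u y1 - Phi u y2| <= C * f2 `|u| * enorm (y1 - y2)) :
  let T := completedType prior in
  let mu0 : probability T R := completion prior in
  [/\ (forall y : 'rV[R]_m, posterior_well_defined mu0 Phi y),
      ((fun u : X => f2 `|u|) \in Lfun mu0 1 ->
       forall r : R, 0 < r -> exists2 C : R, 0 < C &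
         forall y y' : 'rV[R]_m, eball r y -> eball r y' ->
         forall mu mu' : probability T R,
           is_posterior mu0 Phi y mu -> is_posterior mu0 Phi y' mu' ->
         forall nu : {sigma_finite_measure set T -> \bar R},
           mu `<< nu -> mu' `<< nu ->
           (d_TV nu mu mu' <= (C * enorm (y - y'))%:E)%E) &
      ((fun u : X => f2 `|u|) \in Lfun mu0 2%:E ->
       forall r : R, 0 < r -> exists2 C : R, 0 < C &
         forall y y' : 'rV[R]_m, eball r y -> eball r y' ->
         forall mu mu' : probability T R,
           is_posterior mu0 Phi y mu -> is_posterior mu0 Phi y' mu' ->
         forall nu : {sigma_finite_measure set T -> \bar R},
           mu `<< nu -> mu' `<< nu ->
           (d_H nu mu mu' <= (C * enorm (y - y'))%:E)%E)].
Proof.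
move=> T mu0.
have mPhi y : measurable_fun setT (Phi^~ y : T -> R).
  apply: continuous_measurable_completion; apply: ball_lipschitz_continuous => r r0.
  (* the maximum makes the ball of data contain [y] *)
  have [|L _ PhiL] := hB (Num.max r (enorm y + 1)).
    by rewrite lt_max r0.
  have sub (v : X) : ball 0 r v -> ball 0 (Num.max r (enorm y + 1)) v.
    by apply: le_ball; rewrite le_max lexx.
  exists L => u1 u2 /sub u1r /sub u2r; apply: PhiL => //.
  by rewrite /eball/= lt_max ltrDl ltr01 orbT.
have f2_ge0 (u : T) : 0 <= f2 `|u : X| by rewrite ltW// f2_gt0.
split.
- move=> y; apply: (@posterior_well_definedT _ T R _ mu0 Phi Phi_ge0 mPhi y).
  exact: measure_is_complete_caratheodory.
- exact: (@d_TV_lipschitz _ T R m mu0 Phi (fun u : X => f2 `|u|) Phi_ge0 mPhi f2_ge0 hC).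
- exact: (@d_H_lipschitz _ T R m mu0 Phi (fun u : X => f2 `|u|) Phi_ge0 mPhi f2_ge0 hC).
Qed.
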